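(* Let $X$ and $Y$ be real Banach spaces, and assume that $X$ is separable. Let $U\colon X\to Y$ be a surjection with the following property: for every $x_0\in X$ there exists an $\varepsilon_{x_0}>0$ such that the restriction of $U$ to $B(x_0,\varepsilon_{x_0})$ is an isometry. Then $U\colon X\to Y$ is an isometry on $X$.
   Context: For a point $x_0$ in a Banach space $X$ and a real number $r>0$, $B(x_0,r):=\{x\in X\mid \lVert x-x_0\rVert\leq r\}$ denotes the closed ball. A mapping $f\colon D\to E$ between subsets $D\subset X$, $E\subset Y$ of Banach spaces is called an isometry if $\lVert f(x_1)-f(x_2)\rVert=\lVert x_1-x_2\rVert$ for all $x_1,x_2\in D$ (no surjectivity or linearity is required). *)

(* Defs.v *)
From mathcomp Require Import all_boot all_order all_algebra.
From mathcomp Require Import all_classical all_reals all_analysis.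

Set Implicit Arguments.
Unset Strict Implicit.
Unset Printing Implicit Defensive.

Import Order.TTheory GRing.Theory Num.Theory.
Import numFieldNormedType.Exports.

Local Open Scope classical_set_scope.
Local Open Scope ring_scope.

Definition separable_space (T : topologicalType) : Prop :=
  exists2 D : set T, countable D & dense D.

(* The restriction of f to D is an isometry: only distances between points of
   D are constrained, and neither linearity nor surjectivity is required. *)
Definition isometry_on (R : realType) (X Y : normedModType R)
    (D : set X) (f : X -> Y) : Prop :=
  forall x1 x2 : X, D x1 -> D x2 -> `|f x1 - f x2| = `|x1 - x2|.

(* Main.v *)
Require Import Defs.
From mathcomp Require Import all_boot all_order all_algebra.
From mathcomp Require Import all_classical all_reals all_analysis.
From mathcomp Require Import ring lra.

(** The theorem holds because a surjective isometry between balls is rigid and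
  its rigidity propagates.

  Start: a separable X is covered by countably many closed balls on which U is
  an isometry. Their images are closed and cover the Banach space Y, so by
  Baire's theorem one of them has interior. This produces a ball around some q
  that U maps isometrically onto a ball of the same radius
  ([exists_ball_onto_ball]).

  Linearization: by a local Mazur-Ulam argument such a U preserves midpoints of
  segments issuing from q ([isometry_ball_midpoint]). Hence U dilates from the
  ball to a surjective isometry V : X -> Y that agrees with U near q
  ([isometry_ball_extension]).

  Propagation: a point x slightly outside a ball is determined by its distances
  to the points of that ball ([equidistant_eq]). So if U is an isometry on a
  large ball and agrees with V on a concentric smaller one, applying this to x
  and to the V-preimage of U x shows agreement on a ball larger by the factor
  5/4, and, by iteration, on the large ball ([isometry_agreement_grows]).

  Conclusion: the interior of the set where U = V is open and nonempty, and it
  is closed because the radius gained by propagation depends only on where U is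
  isometric and not on the ball of agreement one starts from. As X is connected,
  U = V everywhere. *)

Import Order.TTheory GRing.Theory Num.Theory.
Import numFieldNormedType.Exports.

Local Open Scope classical_set_scope.
Local Open Scope ring_scope.

(** * Archimedean estimates *)

Lemma natmul_bounded_le0 (R : realType) (a b : R) :
  (forall k : nat, k%:R * a <= b) -> a <= 0.
Proof.
move=> bound; rewrite leNgt; apply/negP => a0.
have /(le_lt_trans (ler_norm _)) := archi_boundP (normr_ge0 (b / a)).
by rewrite ltr_pdivrMr// ltNge bound.
Qed.

Lemma exists_pow2_ge (R : realType) (a b : R) :
  0 < b -> exists n : nat, a <= 2 ^+ n * b.
Proof.
move=> b0; apply: contrapT => /forallNP small.
suff : b <= 0 by rewrite leNgt b0.
apply: (@natmul_bounded_le0 _ _ a) => k.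
have /negP := small k; rewrite -ltNge => /ltW; apply: le_trans.
by rewrite ler_wpM2r ?ltW// -natrX ltr_nat ltn_expl.
Qed.

Lemma exists_invS_lt (R : realType) (e : R) :
  0 < e -> exists n : nat, n.+1%:R^-1 < e.
Proof.
move=> e0; have ltN := archi_boundP (normr_ge0 e^-1).
exists (Num.bound `|e^-1|); rewrite invf_plt ?posrE//.
by rewrite (le_lt_trans (ler_norm _))// (lt_trans ltN)// ltr_nat.
Qed.

(** * Distances to a ball determine nearby points *)

(** Put w = v - x. As |v - z| = |x - (z - w)|, shifting a point z of the ball by
  -w does not change its distance to x. Applied to the multiples of w that lie in
  the ball, this gives |x - i * w| = |x| as long as i * |w| <= r. By convexity
  the segment from x to x - i * w lies in the ball of radius |x|; scaling it by
  lam = r / |x| puts points lam * x - j * w into the given ball, which are then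
  all as close to x as lam * x, namely at distance s = |x| - r. So the triangle
  inequality bounds the multiples of w by 2 * s, and such multiples stay well
  inside the ball: the induction on k goes on forever, and w = 0. The bound 5 / 4
  ensures 4 * s <= r, so that i = 2 * k is within reach at step k. *)
Lemma equidistant_eq (R : realType) (X : normedModType R) (r : R) (x v : X) :
  0 < r -> `|x| <= 5 / 4 * r ->
  (forall z : X, `|z| <= r -> `|v - z| = `|x - z|) -> v = x.
Proof.
move=> r0 xr eqd; have [xler|rltx] := leP `|x| r.
  by apply/eqP; rewrite -subr_eq0 -normr_eq0 eqd// subrr normr0.
have [w vE] : exists w, v = x + w by exists (v - x); rewrite addrC subrK.
have x0 : 0 < `|x| by exact: lt_trans rltx.
pose s := `|x| - r.
(* Shift z = (i + 1) * w by -w. *)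
have axis i : i%:R * `|w| <= r -> `|x - i%:R *: w| = `|x|.
  elim: i => [|i IH] iw; first by rewrite scale0r subr0.
  rewrite -eqd; last by rewrite normrZ normr_nat.
  rewrite -IH; last by apply: le_trans iw; rewrite ler_wpM2r// ler_nat.
  by rewrite vE -natr1 scalerDl scale1r opprD addrACA subrr addr0.
pose lam := r / `|x|.
have lam_x : lam * `|x| = r by rewrite /lam divfK// gt_eqF.
have lam0 : 0 <= lam by rewrite divr_ge0// ltW.
have lam_ge : 1 / 2 <= lam by rewrite /lam ler_pdivlMr//; lra.
have lam_le : lam <= 1 by rewrite /lam ler_pdivrMr// mul1r ltW.
suff bound k : k%:R * `|w| <= 2 * s.
  have := natmul_bounded_le0 _ _ _ bound.
  by rewrite normr_le0 => /eqP w0; rewrite vE w0 addr0.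
elim: k => [|k IH]; first by rewrite mul0r /s; lra.
(* The weights lam - th and th are put on x and x - 2 * k * w, both of norm |x|;
   lam >= 1 / 2 >= th keeps them nonnegative. *)
have foot j : (j <= k)%N -> `|lam *: x - j%:R *: w| <= r.
  case: (posnP k) => [->|k0 jk].
    by rewrite leqn0 => /eqP ->; rewrite scale0r subr0 normrZ ger0_norm// lam_x.
  pose th : R := j%:R / (2 * k%:R).
  have k0' : 0 < k%:R :> R by rewrite ltr0n.
  have th0 : 0 <= th by rewrite divr_ge0// mulr_ge0.
  have th1 : th <= 1 / 2.
    rewrite /th ler_pdivrMr; last by rewrite mulr_gt0.
    by rewrite mulrA mul1r mulVf// mul1r ler_nat.
  have thE : th * (2 * k)%:R = j%:R.
    by rewrite natrM /th divfK// mulf_neq0// gt_eqF.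
  clearbody th.
  have -> : lam *: x - j%:R *: w = (lam - th) *: x + th *: (x - (2 * k)%:R *: w).
    by rewrite scalerBr scalerA thE scalerBl addrA subrK.
  rewrite (le_trans (ler_normD _ _))// !normrZ axis; last first.
    by rewrite natrM -mulrA; rewrite /s in IH; lra.
  rewrite (ger0_norm th0) ger0_norm; last by lra.
  by rewrite -mulrDl subrK lam_x.
have side j : (j <= k.+1)%N -> `|x - lam *: x + j%:R *: w| = s.
  elim: j => [_|j IHj jk].
    rewrite scale0r addr0 -[X in X - _]scale1r -scalerBl normrZ ger0_norm ?subr_ge0//.
    by rewrite mulrBl mul1r lam_x.
  rewrite -IHj; last exact: ltnW.
  have -> : x - lam *: x + j.+1%:R *: w = v - (lam *: x - j%:R *: w).
    rewrite vE opprB [_ *: w - _]addrC [RHS]addrACA -natr1 scalerDl scale1r.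
    by rewrite [w + _]addrC.
  by rewrite eqd ?foot// opprB addrA addrAC.
have -> : k.+1%:R * `|w| = `|(x - lam *: x + k.+1%:R *: w) - (x - lam *: x + 0%:R *: w)|.
  by rewrite scale0r addr0 addrAC subrr add0r normrZ normr_nat.
by rewrite (le_trans (ler_normB _ _))// !side// mulr_natl mulr2n.
Qed.

(** * Local Mazur-Ulam theorem *)

(** Vaisala's argument. With psi the reflection in m, the map
  psi o g^-1 o psi o g is again an isometric bijection of E, and it displaces m
  twice as far as g does. Iteration contradicts boundedness of E unless g fixes
  m. The inverse k is a parameter because the iteration conjugates it too. *)
Lemma bounded_symmetric_fixpoint (R : realType) (X : normedModType R)
    (E : set X) (m : X) (r : R) (g k : X -> X) :
  E m -> (forall z, E z -> E (m *+ 2 - z)) -> (forall z, E z -> `|z - m| <= r) ->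
  (forall z, E z -> E (g z)) -> (forall z, E z -> E (k z)) ->
  (forall z, E z -> k (g z) = z) -> (forall z, E z -> g (k z) = z) ->
  isometry_on E g -> g m = m.
Proof.
move=> Em Epsi Er; pose psi z := m *+ 2 - z.
have psiK z : psi (psi z) = z by rewrite /psi opprB addrC subrK.
have psi_iso y z : `|psi y - psi z| = `|y - z|.
  by rewrite /psi opprB addrC addrA subrK distrC.
move=> gE kE gK kK giso.
suff bound n : 2 ^+ n * `|g m - m| <= r.
  apply/eqP; rewrite -subr_eq0 -normr_eq0; apply/eqP/le_anti.
  rewrite normr_ge0 andbT; apply: (@natmul_bounded_le0 _ _ r) => k'.
  by rewrite (le_trans _ (bound k'))// ler_wpM2r// -natrX ler_nat ltnW// ltn_expl.
elim: n g k gE kE gK kK giso => [|n IH] g k gE kE gK kK giso.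
  by rewrite mul1r; apply/Er/gE.
pose g' z := psi (k (psi (g z))); pose k' z := k (psi (g (psi z))).
have kiso y z : E y -> E z -> `|k y - k z| = `|y - z|.
  by move=> Ey Ez; rewrite -giso ?kK//; exact: kE.
have /IH : forall z, E z -> E (g' z).
  by move=> z Ez; apply/Epsi/kE/Epsi/gE.
have k'E z : E z -> E (k' z).
  by move=> Ez; apply/kE/Epsi/gE/Epsi.
move=> /(_ k' k'E).
have g'K z : E z -> k' (g' z) = z.
  move=> Ez; rewrite /k' /g' psiK kK ?psiK ?gK//; exact/Epsi/gE.
have k'K z : E z -> g' (k' z) = z.
  move=> Ez; rewrite /k' /g' kK ?psiK ?gK ?psiK//; first exact: Epsi.
  exact/Epsi/gE/Epsi.
move=> /(_ g'K k'K) bound.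
have g'iso : isometry_on E g'.
  by move=> y z Ey Ez; rewrite /g' psi_iso kiso ?psi_iso ?giso//; exact/Epsi/gE.
have {bound} := bound g'iso.
have psim : psi m = m by rewrite /psi mulr2n addrK.
(* Both sides equal |psi (g m) - g m|, as psi and k are isometric. *)
have -> : `|g' m - m| = 2 * `|g m - m|.
  rewrite /g' -{2}psim psi_iso -{2}(gK m)// kiso//; [|exact/Epsi/gE|exact: gE].
  rewrite /psi distrC opprB addrA -mulr2n -mulrnBl normrMn.
  by rewrite mulr_natl.
by rewrite mulrA -exprSr.
Qed.

(** The Mazur-Ulam reflection argument, confined to a ball: the lens E of points
  within |h| of both q and q + h is bounded, symmetric about the midpoint m, and
  contained in the ball, and f carries it onto the analogous lens E'. Following f
  by the reflection rho of E' and by f^-1 gives a bijective isometry of E, which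
  must fix m; this says that f m is the midpoint of f q and f (q + h). *)
Lemma isometry_ball_midpoint (R : realType) (X Y : normedModType R)
    (f : X -> Y) (q h : X) (d : R) :
  isometry_on (closed_ball_ Num.norm q d) f ->
  closed_ball_ Num.norm (f q) d `<=` f @` closed_ball_ Num.norm q d ->
  2 * `|h| <= d ->
  f (q + h) - f q = 2 *: (f (q + 2^-1 *: h) - f q).
Proof.
move=> fiso fsurj hd.
have /choice[k kP] : forall y, exists x, closed_ball_ Num.norm (f q) d y ->
    closed_ball_ Num.norm q d x /\ f x = y.
  move=> y; have [|yP] := pselect (closed_ball_ Num.norm (f q) d y); last by exists q.
  by move=> /fsurj[x xq fx]; exists x.
have h0 := normr_ge0 h.
have d0 : 0 <= d by lra.
have bq : closed_ball_ Num.norm q d q by rewrite /closed_ball_ /= subrr normr0.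
have bqh : closed_ball_ Num.norm q d (q + h).
  by rewrite /closed_ball_ /= opprD addNKr normrN; lra.
pose E : set X := [set z | `|q - z| <= `|h| /\ `|q + h - z| <= `|h|].
pose E' : set Y := [set y | `|f q - y| <= `|h| /\ `|f (q + h) - y| <= `|h|].
have EB z : E z -> closed_ball_ Num.norm q d z.
  by rewrite /closed_ball_ /=; case=> + _; lra.
have E'B y : E' y -> closed_ball_ Num.norm (f q) d y.
  by rewrite /closed_ball_ /=; case=> + _; lra.
have fE z : E z -> E' (f z).
  by move=> Ez; case: (Ez) => ? ?; split; rewrite fiso//; exact: EB.
have kB y : E' y -> closed_ball_ Num.norm q d (k y) by move=> /E'B/kP[].
have fk y : E' y -> f (k y) = y by move=> /E'B/kP[].
have kE y : E' y -> E (k y).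
  move=> Ey; case: (Ey) => ? ?; split; rewrite -fiso ?fk//; exact: kB.
have finj z z' : E z -> E z' -> f z = f z' -> z = z'.
  move=> Ez Ez' ff; apply/eqP; rewrite -subr_eq0 -normr_eq0 -fiso; try exact: EB.
  by rewrite ff subrr normr0.
have kf z : E z -> k (f z) = z.
  by move=> Ez; apply: finj; [exact/kE/fE | exact: Ez | exact/fk/fE].
pose rho y := f q + f (q + h) - y.
have rhoE y : E' y -> E' (rho y).
  case=> yq yqh; split.
    by rewrite /rho opprB addrA addrAC opprD addrA subrr add0r addrC distrC.
  by rewrite /rho [f q + _]addrC -addrA opprD addrA subrr add0r opprB distrC.
have rhoK y : rho (rho y) = y by rewrite /rho opprB addrC subrK.
pose g z := k (rho (f z)).
have gE z : E z -> E (g z) by move=> Ez; exact/kE/rhoE/fE.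
have gK z : E z -> g (g z) = z.
  by move=> Ez; rewrite /g fk ?rhoK ?kf//; exact/rhoE/fE.
have giso : isometry_on E g.
  move=> y z Ey Ez; rewrite -fiso; try exact/EB/gE.
  rewrite /g !fk; try exact/rhoE/fE.
  by rewrite /rho opprB addrC addrA subrK distrC fiso//; exact: EB.
pose m := q + 2^-1 *: h.
have half_h : `|2^-1 *: h| <= `|h| by rewrite normrZ ger0_norm; lra.
have h2 : h - 2^-1 *: h = 2^-1 *: h.
  by rewrite -[X in X - _]scale1r -scalerBl; congr (_ *: _); field.
have Em : E m.
  split; rewrite /m; first by rewrite opprD addNKr normrN.
  by rewrite opprD addrACA subrr add0r h2.
have m2 : m *+ 2 = q + h + q.
  rewrite /m mulr2n addrACA -scalerDl addrAC -[X in X *: h](_ : 1 = _) ?scale1r//.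
  by field.
have : g m = m.
  apply: (@bounded_symmetric_fixpoint _ _ E _ (2 * `|h|) g g) => // z [zq zqh].
    rewrite m2; split.
      by rewrite opprB addrCA (opprD (q + h)) [X in z + X]addrCA subrr addr0 distrC.
    by rewrite opprB addrCA (opprD (q + h)) addNKr distrC.
  rewrite -(subrK q z) -addrA (le_trans (ler_normD _ _))// mulr_natl mulr2n lerD//.
    by rewrite distrC.
  by rewrite /m opprD addNKr normrN.
move=> /(congr1 f); rewrite {1}/g fk; last exact/rhoE/fE.
rewrite /rho -/m => /eqP; rewrite subr_eq => /eqP fm.
by rewrite scalerBr !scaler_nat !mulr2n -fm opprD [f q + _]addrC addrA addrK.
Qed.

(** The map phi n is f conjugated by the homotheties of ratio 2 ^ n centred at q
  and f q. Since f respects doubling at q, the maps phi n agree on their common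
  domains of control, and V is their common extension; isometry and surjectivity
  of V are read off phi n for n large. *)
Lemma isometry_ball_extension (R : realType) (X Y : normedModType R)
    (f : X -> Y) (q : X) (d : R) :
  0 < d -> isometry_on (closed_ball_ Num.norm q d) f ->
  closed_ball_ Num.norm (f q) d `<=` f @` closed_ball_ Num.norm q d ->
  exists V : X -> Y, [/\ isometry_on [set: X] V, set_surj [set: X] [set: Y] V &
    forall x, closed_ball_ Num.norm q (d / 2) x -> V x = f x].
Proof.
move=> d0 fiso fsurj.
pose phi n x := f q + 2 ^+ n *: (f (q + (2 ^+ n)^-1 *: (x - q)) - f q).
have pow0 n : 0 < 2 ^+ n :> R by rewrite exprn_gt0.
have shrink n (T : normedModType R) (z : T) :
    `|z| <= 2 ^+ n * (d / 2) -> `|(2 ^+ n)^-1 *: z| <= d / 2.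
  by move=> zd; rewrite normrZ gtr0_norm ?invr_gt0// ler_pdivrMl.
have phiS n x : `|x - q| <= 2 ^+ n * (d / 2) -> phi n.+1 x = phi n x.
  move=> /shrink xd; rewrite /phi.
  rewrite (@isometry_ball_midpoint _ _ _ f q ((2 ^+ n)^-1 *: (x - q)) d)//; last by lra.
  by rewrite !scalerA -exprSr exprS invfM.
have mono n m : (n <= m)%N -> 2 ^+ n * (d / 2) <= 2 ^+ m * (d / 2).
  by move=> nm; rewrite ler_pM2r ?divr_gt0// ler_weXn2l// ler1n.
have phi_stable n m x : `|x - q| <= 2 ^+ n * (d / 2) -> (n <= m)%N -> phi m x = phi n x.
  move=> xn; elim: m => [|m IH]; first by rewrite leqn0 => /eqP ->.
  rewrite leq_eqVlt ltnS => /predU1P[->//|nm].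
  by rewrite phiS ?IH// (le_trans xn)// mono.
have /choice[N NP] : forall x, exists n, `|x - q| <= 2 ^+ n * (d / 2).
  by move=> x; apply: exists_pow2_ge; rewrite divr_gt0.
pose V x := phi (N x) x.
have VE n x : `|x - q| <= 2 ^+ n * (d / 2) -> V x = phi n x.
  move=> xn; case/orP: (leq_total n (N x)) => nN; first exact: phi_stable.
  by apply/esym/phi_stable.
exists V; split.
- move=> x y _ _.
  pose n := maxn (N x) (N y).
  have xn : `|x - q| <= 2 ^+ n * (d / 2) by rewrite (le_trans (NP x))// mono// leq_maxl.
  have yn : `|y - q| <= 2 ^+ n * (d / 2) by rewrite (le_trans (NP y))// mono// leq_maxr.
  have inball z : `|z - q| <= 2 ^+ n * (d / 2) ->
      closed_ball_ Num.norm q d (q + (2 ^+ n)^-1 *: (z - q)).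
    by move=> /shrink; rewrite /closed_ball_ /= opprD addNKr normrN; lra.
  rewrite !(VE n)// /phi opprD addrACA subrr add0r -scalerBr opprB addrA subrK.
  rewrite normrZ fiso; try exact: inball.
  rewrite opprD addrACA subrr add0r -scalerBr opprB addrA subrK normrZ mulrA.
  by rewrite -normrM divff ?normr1 ?mul1r// gt_eqF.
- move=> y _.
  have [n yn] : exists n, `|y - f q| <= 2 ^+ n * (d / 2).
    by apply: exists_pow2_ge; rewrite divr_gt0.
  have /shrink := yn => yd.
  have [] := fsurj (f q + (2 ^+ n)^-1 *: (y - f q)).
    by rewrite /closed_ball_ /= opprD addNKr normrN; lra.
  move=> c cq fc.
  have cd : `|c - q| <= d / 2.
    rewrite -fiso//; last by rewrite /closed_ball_ /= subrr normr0 ltW.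
    by rewrite fc addrAC subrr add0r.
  exists (q + 2 ^+ n *: (c - q)) => //.
  have pn : 2 ^+ n != 0 :> R by rewrite gt_eqF.
  have xE : q + 2 ^+ n *: (c - q) - q = 2 ^+ n *: (c - q) by rewrite addrAC subrr add0r.
  rewrite (VE n); last by rewrite xE normrZ gtr0_norm// ler_pM2l.
  rewrite /phi xE scalerA mulVf// scale1r [q + _]addrC subrK fc.
  by rewrite addrAC subrr add0r scalerA divff// scale1r addrC subrK.
- move=> x xq; rewrite (VE 0%N); last by rewrite expr0 mul1r distrC.
  by rewrite /phi expr0 invr1 !scale1r [q + _]addrC subrK [f q + _]addrC subrK.
Qed.

(** * A ball mapped onto a ball *)

(** A sequence of values converging in Y comes from a Cauchy sequence in C, because
  f preserves distances; completeness of X provides a preimage of the limit. *)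
Lemma closed_isometry_image (R : realType) (X : completeNormedModType R)
    (Y : normedModType R) (C : set X) (f : X -> Y) :
  closed C -> isometry_on C f -> closed (f @` C).
Proof.
move=> clC fiso y cly.
have /choice[c cP] : forall n : nat, exists x, C x /\ `|y - f x| < n.+1%:R^-1.
  move=> n; have [|_ [[x Cx <-] yx]] := cly (ball y n.+1%:R^-1).
    exact: nbhsx_ballx.
  by exists x; split => //; move: yx; rewrite -ball_normE.
have cC n : C (c n) by have [] := cP n.
have cy n m : (n <= m)%N -> `|y - f (c m)| < n.+1%:R^-1.
  move=> nm; have [_ /lt_le_trans] := cP m; apply.
  by rewrite lef_pV2 ?posrE// ler_nat ltnS.
have /cauchy_cvgP cvc : cauchy (c @ \oo).
  apply: cauchy_exP => e e0.
  have [n ne] : exists n : nat, n.+1%:R^-1 < e / 2.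
    by apply: exists_invS_lt; rewrite divr_gt0.
  exists (c n); exists n => // m /= nm.
  rewrite -ball_normE /= -fiso//.
  have := ler_distD y (f (c n)) (f (c m)); rewrite [`|f (c n) - y|]distrC.
  by have := lt_trans (cy n n (leqnn n)) ne; have := lt_trans (cy n m nm) ne; lra.
pose x := lim (c @ \oo).
have Cx : C x by apply: (closed_cvg C clC _ _ cvc); exists 0%N => // n _; exact: cC.
exists x => //; apply/esym/eqP; rewrite -subr_eq0 -normr_le0.
apply/ler_addgt0Pl => e e0; rewrite addr0.
have [n ne] : exists n : nat, n.+1%:R^-1 < e / 2.
  by apply: exists_invS_lt; rewrite divr_gt0.
have : \forall m \near \oo, `|x - c m| < e / 2.
  by move/cvgrPdist_lt : cvc; apply; rewrite divr_gt0.
case=> m _ /(_ (maxn n m) (leq_maxr _ _)) /=.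
have := lt_trans (cy n (maxn n m) (leq_maxl _ _)) ne.
rewrite -fiso// [`|f x - _|]distrC.
by have := ler_distD (f (c (maxn n m))) y (f x); lra.
Qed.

(** There is no lower bound for the radius at points of a dense sequence, so the
  radii given at these points need not yield a cover. Instead, among all balls
  with centre in a dense sequence and radius 1 / (n + 1), the relevant ones are
  those on which U is isometric: a centre close to x inherits almost half of the
  radius available at x. *)
Lemma countable_isometry_cover (R : realType) (X Y : normedModType R)
    (U : X -> Y) :
  separable_space X ->
  (forall x : X, exists2 e : R, 0 < e & isometry_on (closed_ball_ Num.norm x e) U) ->
  exists (c : nat -> X) (r : nat -> R),
    (forall n, 0 < r n /\ isometry_on (closed_ball_ Num.norm (c n) (r n)) U) /\
    (forall x, exists n, closed_ball_ Num.norm (c n) (r n) x).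
Proof.
move=> [D /pcard_surjP[s sD] dD] locU.
pose good (p : nat * nat) :=
  isometry_on (closed_ball_ Num.norm (s p.1) (p.2.+1%:R^-1 : R)) U.
have /choice[cr crP] : forall k : nat, exists cr : X * R,
    (0 < cr.2 /\ isometry_on (closed_ball_ Num.norm cr.1 cr.2) U) /\
    (forall p : nat * nat, pickle p = k -> good p ->
      cr = (s p.1, p.2.+1%:R^-1)).
  move=> k; have [[p [pk gp]]|nop] := pselect (exists p, pickle p = k /\ good p).
    exists (s p.1, p.2.+1%:R^-1); split; first by split => //=; rewrite invr_gt0.
    by move=> p'; rewrite -pk => /(pcan_inj pickleK) ->.
  (* An index coding no good ball is given an arbitrary isometric ball. *)
  have [e e0 Ue] := locU 0; exists (0, e); split => // p pk gp.
  by exfalso; apply: nop; exists p.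
exists (fst \o cr), (snd \o cr); split; first by move=> n; case: (crP n).
move=> x; have [e e0 Ue] := locU x.
have [n ne] : exists n : nat, n.+1%:R^-1 < e / 2.
  by apply: exists_invS_lt; rewrite divr_gt0.
have n0 : 0 < n.+1%:R^-1 :> R by rewrite invr_gt0.
have [||z [xz Dz]] := dD (ball x n.+1%:R^-1).
- by exists x; exact: ballxx.
- exact: ball_open.
have [i _ si] := sD _ Dz.
move: xz; rewrite -ball_normE /= => xz.
have gin : good (i, n).
  move=> a b /=; rewrite /closed_ball_ /= si => /le_lt_trans/(_ ne) za.
  move=> /le_lt_trans/(_ ne) zb.
  have xz' := lt_trans xz ne; apply: Ue; rewrite /closed_ball_ /=.
    by have := ler_distD z x a; lra.
  by have := ler_distD z x b; lra.
exists (pickle (i, n)) => /=; have [_ /(_ (i, n) erefl gin) ->] := crP (pickle (i, n)).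
by rewrite /closed_ball_ /= si distrC ltW.
Qed.

(** Baire's theorem gives a ball B n whose image contains a ball around some
  y0 = U x0, but x0 may lie on the boundary of B n. Moving from x0 towards the
  centre by a small proportion t reaches a point x1 whose ball of radius t * r n
  lies in B n, while U x1 is still close to y0; as U is isometric on B n, the
  preimages in B n of points close to U x1 are equally close to x1. *)
Lemma exists_ball_onto_ball (R : realType) (X Y : completeNormedModType R)
    (U : X -> Y) :
  separable_space X -> set_surj [set: X] [set: Y] U ->
  (forall x : X, exists2 e : R, 0 < e & isometry_on (closed_ball_ Num.norm x e) U) ->
  exists (q : X) (d : R), [/\ 0 < d, isometry_on (closed_ball_ Num.norm q d) U &
    closed_ball_ Num.norm (U q) d `<=` U @` closed_ball_ Num.norm q d].
Proof.
move=> sepX surjU locU.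
have [c [r [crU cov]]] := countable_isometry_cover _ _ _ _ sepX locU.
pose B n := closed_ball_ Num.norm (c n) (r n).
have [n nd] : exists n, ~ dense (~` (U @` B n)).
  apply/existsNP => dF.
  have : dense (\bigcap_n ~` (U @` B n)).
    apply: Baire => n; split => //; rewrite openC.
    apply: closed_isometry_image; last by case: (crU n).
    by apply: closed_closed_ball_; case: (crU n).
  case/(_ setT); [by exists 0 | exact: openT | move=> y [_ yF]].
  have [x _ Uxy] := surjU y I; have [n xn] := cov x.
  by apply: (yF n I); exists x.
have [r0 Uiso] := crU n.
have [W [[y0 Wy0] WF]] := denseNE nd.
have sWB : W `<=` U @` B n.
  by rewrite -[X in _ `<=` X]setCK -disjoints_subset.
have /nbhs_ballP[e /= e0 eW] : nbhs y0 W by exact: open_nbhs_nbhs.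
have [x0 Bx0 Ux0] : (U @` B n) y0 by apply/sWB/eW/ballxx.
pose t := e / (e + 2 * r n).
have den0 : 0 < e + 2 * r n by rewrite addr_gt0// mulr_gt0.
have t0 : 0 < t by rewrite divr_gt0.
have tr : 2 * (t * r n) < e.
  have : t * (e + 2 * r n) = e by rewrite divfK// gt_eqF.
  by have := mulr_gt0 t0 e0; lra.
have t1 : t <= 1 by rewrite ler_pdivrMr// mul1r lerDl mulr_ge0// ltW.
have x0r : `|c n - x0| <= r n by exact: Bx0.
clearbody t.
pose x1 := x0 + t *: (c n - x0).
have cx1 : `|c n - x1| <= (1 - t) * r n.
  rewrite /x1 opprD addrA -[X in X - _]scale1r -scalerBl normrZ ger0_norm ?subr_ge0//.
  by rewrite ler_wpM2l// subr_ge0.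
have x01 : `|x0 - x1| <= t * r n.
  by rewrite /x1 opprD addNKr normrN normrZ gtr0_norm// ler_pM2l.
have sub : closed_ball_ Num.norm x1 (t * r n) `<=` B n.
  move=> z; rewrite /B /closed_ball_ /= => x1z.
  by have := ler_distD x1 (c n) z; lra.
have Bx1 : B n x1 by apply: sub; rewrite /closed_ball_ /= subrr normr0 mulr_ge0// ltW.
exists x1, (t * r n); split.
- by rewrite mulr_gt0.
- by move=> a b /sub Ba /sub Bb; exact: Uiso.
- move=> y; rewrite /closed_ball_ /= => yx1.
  have [x Bx Ux] : (U @` B n) y.
    apply/sWB/eW; rewrite -ball_normE /=.
    rewrite (le_lt_trans (ler_distD (U x1) _ _))//.
    by rewrite -Ux0 Uiso//; lra.
  by exists x => //; rewrite /closed_ball_ /= -Uiso// Ux.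
Qed.

(** * Propagation of agreement *)

(** For x beyond the current ball of agreement, let v be the point with V v = U x.
  For z in this ball, |v - z| = |V v - V z| = |U x - U z| = |x - z|, so
  [equidistant_eq] gives v = x if x is not too far out. *)
Lemma isometry_agreement_grows (R : realType) (X Y : normedModType R)
    (U V : X -> Y) (q : X) (r d : R) :
  isometry_on [set: X] V -> set_surj [set: X] [set: Y] V ->
  0 < r -> isometry_on (closed_ball_ Num.norm q d) U ->
  (forall x, closed_ball_ Num.norm q r x -> U x = V x) ->
  forall x, closed_ball_ Num.norm q d x -> U x = V x.
Proof.
move=> Viso Vsurj r0 Uiso UV.
have step n x : `|q - x| <= d -> `|q - x| <= (5 / 4) ^+ n * r -> U x = V x.
  elim: n x => [|n IH] x xd xn; first by apply: UV; rewrite /closed_ball_ /= -[r]mul1r.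
  set r' := (5 / 4) ^+ n * r in IH.
  have r'0 : 0 < r' by rewrite /r' mulr_gt0// exprn_gt0.
  have [|dr'] := leP `|q - x| r'; first exact: IH.
  have [v _ Vv] := Vsurj (U x) I.
  suff : v - q = x - q by move=> /addIr vx; rewrite -Vv vx.
  apply: (@equidistant_eq _ _ r') => //.
    by rewrite distrC (le_trans xn)// exprS -mulrA.
  move=> z zr'; rewrite -!addrA -!opprD.
  have qz : `|q - (q + z)| <= r' by rewrite opprD addNKr normrN.
  have qzd : `|q - (q + z)| <= d by rewrite (le_trans qz)// (le_trans (ltW dr')).
  by rewrite -Viso// Vv -IH// Uiso.
move=> x xd.
have [n nd] := exists_pow2_ge _ d _ r0.
apply: (step (4 * n)%N) => //; rewrite (le_trans xd)// (le_trans nd)//.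
(* Four steps suffice to double the radius, as (5 / 4) ^ 4 >= 2. *)
rewrite ler_pM2r// exprM lerXn2r ?nnegrE// ?exprn_ge0//.
by rewrite !exprS expr0; lra.
Qed.

(** The line joining a point of S to x is connected and meets S in a clopen set. *)
Lemma clopen_setT (R : realType) (X : normedModType R) (S : set X) :
  open S -> closed S -> S !=set0 -> S = [set: X].
Proof.
move=> oS cS [q Sq]; apply/seteqP; split => // x _.
pose g (t : R) := q + t *: (x - q).
have gc : continuous g.
  by move=> t; apply: cvgD; [exact: cvg_cst | apply: cvgZr_tmp; exact: cvg_id].
have /connected_intervalP cR : is_interval [set: R] by [].
have gS : g @^-1` S = [set: R].
  apply: cR.
  - by exists 0; rewrite /= /g scale0r addr0.
  - by exists (g @^-1` S); rewrite ?setTI//; apply: open_comp.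
  - by exists (g @^-1` S); rewrite ?setTI//; apply: preimage_closed.
have : (g @^-1` S) 1 by rewrite gS.
by rewrite /= /g scale1r addrC subrK.
Qed.

(** * Locally isometric surjections are isometries *)

Theorem theorem3 (R : realType) (X Y : completeNormedModType R)
    (sepX : separable_space X)
    (U : X -> Y) (surjU : set_surj [set: X] [set: Y] U)
    (locU : forall x0 : X, exists2 e : R,
      0 < e & isometry_on (closed_ball_ Num.norm x0 e) U) :
  isometry_on [set: X] U.
Proof.
have [q0 [d [d0 Uiso Uonto]]] := exists_ball_onto_ball _ _ _ _ sepX surjU locU.
have [V [Viso Vsurj VU]] := isometry_ball_extension _ _ _ _ _ _ d0 Uiso Uonto.
pose S := ([set x | U x = V x]°).
suff ST : S = [set: X].
  have UV x : U x = V x.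
    by apply: (@interior_subset _ [set x | U x = V x]); rewrite -/S ST.
  by move=> x y _ _; rewrite !UV Viso.
have ball_sub_S q r : 0 < r ->
    (forall x, closed_ball_ Num.norm q r x -> U x = V x) -> S q.
  move=> r0 UV; apply/nbhs_ballP; exists r => // x.
  by rewrite -ball_normE => /ltW; exact: UV.
apply: clopen_setT.
- exact: open_interior.
- move=> p clS; have [e e0 Ue] := locU p.
  have [|q [Sq pq]] := clS (ball p (e / 4)).
    by apply: nbhsx_ballx; rewrite divr_gt0.
  move: pq; rewrite -ball_normE /= => pq.
  have /nbhs_closedballP[r UVr] := Sq.
  rewrite closed_ballE// in UVr.
  have Uq : isometry_on (closed_ball_ Num.norm q (e / 2)) U.
    move=> a b; rewrite /closed_ball_ /= => qa qb; apply: Ue; rewrite /closed_ball_ /=.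
      by have := ler_distD q p a; lra.
    by have := ler_distD q p b; lra.
  have UVq := isometry_agreement_grows _ _ _ _ _ _ _ _ Viso Vsurj (gt0 r) Uq UVr.
  apply: (ball_sub_S _ (e / 4)); first by rewrite divr_gt0.
  move=> x; rewrite /closed_ball_ /= => px; apply: UVq; rewrite /closed_ball_ /=.
  by have := ler_distD p q x; rewrite [`|q - p|]distrC; lra.
- by exists q0; apply: (ball_sub_S _ (d / 2)) => [|x /VU ->//]; rewrite divr_gt0.
Qed.
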